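(* Let $\mathcal{G}(\pi)$ be a colored directed graph with vertex set $V$ and let $V_L\subseteq V$ be a leader set. Let $\mathcal{D}_{ec}(V_L)$ be an edge-operations-color-change derived set of $V_L$. Then $(\mathcal{G}(\pi);V_L)$ is controllable if $\mathcal{D}_{ec}(V_L)=V$.
   Context: Directed graphs $\mathcal{G}=(V,E)$ are simple: $V=\{1,\dots,n\}$, $E\subseteq V\times V$, and $E$ contains no edge $(i,i)$. A colored directed graph $\mathcal{G}(\pi)=(V,E,\pi)$ is a directed graph with a partition $\pi=\{E_1,\dots,E_k\}$ of $E$; edges in $E_r$ are said to have color $c_r$, and $\{c_1,\dots,c_k\}$ is the color set. Controllability. The qualitative class is $\mathcal{Q}(\mathcal{G})=\{A\in\mathbb{R}^{n\times n}\mid \text{for } i\neq j:\ A_{ij}\neq 0 \text{ iff } (j,i)\in E\}$ (diagonal entries are arbitrary reals), and the colored qualitative class is $\mathcal{Q}_\pi(\mathcal{G})=\{A\in\mathcal{Q}(\mathcal{G})\mid A_{ij}=A_{kl}\text{ if }(j,i),(l,k)\in E_r\text{ for some }r\}$. For a leader set $V_L=\{v_1,\dots,v_m\}\subseteq V$, let $B=B(V;V_L)\in\mathbb{R}^{n\times m}$ with $B_{ij}=1$ if $i=v_j$ and $B_{ij}=0$ otherwise. $(\mathcal{G}(\pi);V_L)$ is called controllable if the pair $(A,B)$ is controllable (in the classical sense for $\dot x=Ax+Bu$) for all $A\in\mathcal{Q}_\pi(\mathcal{G})$. Associated colored bipartite graphs. For disjoint $X=\{x_1,\dots,x_s\}$,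 $Y=\{y_1,\dots,y_t\}\subseteq V$, the associated colored bipartite graph has edge set $E_{XY}=\{\{x_i,y_j\}\mid (x_i,y_j)\in E\}$, where $\{x_i,y_j\}$ inherits the color of $(x_i,y_j)$. If $s=t$, a perfect matching is a set of edges $\{\{x_1,y_{\gamma(1)}\},\dots,\{x_t,y_{\gamma(t)}\}\}\subseteq E_{XY}$ with $\gamma$ a permutation of $(1,\dots,t)$; its sign is the sign of $\gamma$; its spectrum is the multiset of colors of its edges. Two perfect matchings are equivalent if they have the same spectrum, and the signature of an equivalence class is the sum of the signs of the perfect matchings in it. Color change rule. A coloring set $C\subseteq V$ is the set of vertices initially colored black; all others are white. For $X\subseteq C$, $N_{V\setminus C}(X)=\{j\in V\setminus C\mid \exists\, i\in X:\ (i,j)\in E\}$. For $X\subseteq C$ and $Y\subseteq V$ with $|X|=|Y|$, $Y$ is a color-perfect white neighbor of $X$ if (1) $Y=N_{V\setminus C}(X)$, and (2) in the colored bipartite graph associated with $X,Y$ there exists a perfect matching and exactly one equivalence class of perfect matchings has nonzero signature. Color change rule: if $C$ is the current set of black vertices, $X\subseteq C$, and $Y$ is a color-perfect white neighbor of $X$, then color all vertices in $Y$ black; write $X\xrightarrow{c}Y$. A derived set $\mathcal{D}_c(C)$ is a set of black vertices obtained from $C$ by repeated application of the color change rule until no more changes are possible (it need not be unique). Elementary edge operations. Let $C\subseteq V$ be a coloring set. For $u\in C$ let $N_{V\setminus C}(u)=\{j\in V\setminus C\mid (u,j)\in E\}$, and for $u,v\in C$ (possibly equal) let $\mathcal{E}_u(v)=\{(v,j)\in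 E\mid j\in N_{V\setminus C}(u)\}$. The two elementary edge operations (with respect to $C$) are: (1) Turn color: for $u\in C$ such that all edges in $\mathcal{E}_u(u)$ have the same color, change the color of these edges to any other color in the color set. (2) Remove edges: for distinct $u,v\in C$ such that $N_{V\setminus C}(u)\subseteq N_{V\setminus C}(v)$ and such that for every $k\in N_{V\setminus C}(u)$ the edges $(u,k)$ and $(v,k)$ have the same color, remove all edges in $\mathcal{E}_u(v)$. The colored graph resulting from applying an operation $o$ to $\mathcal{G}(\pi)$ is called the derived graph with respect to $C$ and $o$, denoted $\mathcal{G}(\pi,C,o)$. Edge-operations-color-change derived set. Start with $\mathcal{G}_0(\pi_0)=\mathcal{G}(\pi)$ and a derived set $\mathcal{D}_0=\mathcal{D}_c(V_L)$ of $V_L$ in $\mathcal{G}_0(\pi_0)$. Iteratively, given $\mathcal{G}_i(\pi_i)$ and $\mathcal{D}_i$, apply an elementary edge operation $o_i$ with respect to the coloring set $\mathcal{D}_i$ to obtain $\mathcal{G}_{i+1}(\pi_{i+1})=\mathcal{G}_i(\pi_i,\mathcal{D}_i,o_i)$, and then let $\mathcal{D}_{i+1}$ be a derived set $\mathcal{D}_c(\mathcal{D}_i)$ of $\mathcal{D}_i$ in $\mathcal{G}_{i+1}(\pi_{i+1})$. The set of black vertices arrived at after finitely many such iterations, which remains unchanged under further application of these steps, is called an edge-operations-color-change derived set of $V_L$ and denoted $\mathcal{D}_{ec}(V_L)$. *)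

(* Defs.v *)
From Stdlib Require Import Relation_Operators.
From mathcomp Require Import all_boot all_order all_fingroup all_algebra.
From mathcomp Require Import reals topology normedtype derive.

Set Implicit Arguments.
Unset Strict Implicit.
Unset Printing Implicit Defensive.

Import GRing.Theory.
Import numFieldNormedType.Exports.

Local Open Scope ring_scope.

(* The vertex set {1, ..., n} is rendered by 'I_n and the color set *)
(* {c_1, ..., c_k} by 'I_k; color_class G r is the set E_r of edges of color *)
(* c_r. *)
Record colored_digraph (n k : nat) := ColoredDigraph {
  edges : {set 'I_n * 'I_n};
  color_class : 'I_k -> {set 'I_n * 'I_n}
}.

(* Non-emptiness of the classes is required of a given colored digraph only: *)
(* the edge operations below keep the color set and may empty a class. *)
Definition is_colored_digraph n k (G : colored_digraph n k) : Prop :=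
  [/\ forall i, (i, i) \notin edges G,
      \bigcup_(r < k) color_class G r = edges G,
      forall r s, r != s -> [disjoint color_class G r & color_class G s]
    & forall r, color_class G r != set0].

Definition same_color n k (G : colored_digraph n k) (e f : 'I_n * 'I_n) : Prop :=
  exists r, e \in color_class G r /\ f \in color_class G r.

Section Controllability.
Variable R : realType.

Definition qualitative_class n (E : {set 'I_n * 'I_n}) (A : 'M[R]_n) : Prop :=
  forall i j, i != j -> (A i j != 0 <-> (j, i) \in E).

Definition colored_qualitative_class n k (G : colored_digraph n k)
    (A : 'M[R]_n) : Prop :=
  qualitative_class (edges G) A /\
  forall i j p q, same_color G (j, i) (q, p) -> A i j = A p q.

(* The leaders v_1, ..., v_m are listed in increasing order. *)
Definition leader_mx n (VL : {set 'I_n}) : 'M[R]_(n, #|VL|) :=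
  \matrix_(i < n, j < #|VL|) (i == enum_val j)%:R.

Definition trajectory n m (A : 'M[R]_n) (B : 'M[R]_(n, m))
    (T : R) (u : R -> 'cV[R]_m) (x : R -> 'cV[R]_n) : Prop :=
  forall t, 0 <= t <= T -> is_derive t 1 x (A *m x t + B *m u t).

(* Complete state controllability of dx/dt = A x + B u, with continuous inputs: *)
(* every state can be steered to every other one in finite time. *)
Definition controllable_pair n m (A : 'M[R]_n) (B : 'M[R]_(n, m)) : Prop :=
  forall x0 x1 : 'cV[R]_n, exists (T : R) (u : R -> 'cV[R]_m) (x : R -> 'cV[R]_n),
    [/\ 0 < T, continuous u, trajectory A B T u x, x 0 = x0 & x T = x1].

Definition controllable n k (G : colored_digraph n k) (VL : {set 'I_n}) : Prop :=
  forall A : 'M[R]_n, colored_qualitative_class G A ->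
    controllable_pair A (leader_mx VL).

End Controllability.

Section PerfectMatchings.
Variables (n k : nat) (G : colored_digraph n k).

(* The vertices of the bipartite graph are listed by x, y : 'I_t -> 'I_n, and *)
(* a perfect matching is given by its permutation. *)
Variables (t : nat) (x y : 'I_t -> 'I_n).

Definition perfect_matchings : {set 'S_t} :=
  [set g : 'S_t | [forall i, (x i, y (g i)) \in edges G]].

(* The multiset of colors, as a multiplicity function. *)
Definition spectrum (g : 'S_t) : {ffun 'I_k -> nat} :=
  [ffun r => #|[set i | (x i, y (g i)) \in color_class G r]|].

Definition matching_classes : {set {set 'S_t}} :=
  preim_partition spectrum perfect_matchings.

Definition signature (K : {set 'S_t}) : int := \sum_(g in K) (-1) ^+ g.

End PerfectMatchings.

Section ColorChange.
Variables (n k : nat) (G : colored_digraph n k).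
Implicit Types C D X Y : {set 'I_n}.

Definition white_neighbors C X : {set 'I_n} :=
  [set j in ~: C | [exists i in X, (i, j) \in edges G]].

(* X and Y are listed in increasing order; other listings change all the *)
(* signatures by a common sign. *)
Definition color_perfect_white_neighbor C X Y : Prop :=
  exists eXY : #|X| = #|Y|,
    let x (i : 'I_#|X|) : 'I_n := enum_val i in
    let y (i : 'I_#|X|) : 'I_n := enum_val (cast_ord eXY i) in
    [/\ Y = white_neighbors C X,
        perfect_matchings G x y != set0
      & #|[set K in matching_classes G x y | signature K != 0]| = 1%N].

Definition color_change C C' : Prop :=
  exists X Y, [/\ X \subset C, color_perfect_white_neighbor C X Y & C' = C :|: Y].

Definition derived_set C D : Prop :=
  clos_refl_trans _ color_change C D /\
  forall D', color_change D D' -> D' = D.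

End ColorChange.

Section EdgeOperations.
Variables (n k : nat).
Implicit Types (G : colored_digraph n k) (C D VL : {set 'I_n}).

Definition white_edges G C (u v : 'I_n) : {set 'I_n * 'I_n} :=
  [set e in edges G | (e.1 == v) && (e.2 \in white_neighbors G C [set u])].

Definition turn_color G (F : {set 'I_n * 'I_n}) (c : 'I_k) : colored_digraph n k :=
  ColoredDigraph (edges G)
    (fun r => if r == c then color_class G r :|: F else color_class G r :\: F).

Definition remove_edges G (F : {set 'I_n * 'I_n}) : colored_digraph n k :=
  ColoredDigraph (edges G :\: F) (fun r => color_class G r :\: F).

Inductive edge_operation C G : colored_digraph n k -> Prop :=
| TurnColor (u : 'I_n) (r c : 'I_k) :
    u \in C -> white_edges G C u u \subset color_class G r -> c != r ->
    edge_operation C G (turn_color G (white_edges G C u u) c)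
| RemoveEdges (u v : 'I_n) :
    u \in C -> v \in C -> u != v ->
    white_neighbors G C [set u] \subset white_neighbors G C [set v] ->
    (forall j, j \in white_neighbors G C [set u] ->
       same_color G (u, j) (v, j)) ->
    edge_operation C G (remove_edges G (white_edges G C u v)).

Definition ec_step (s s' : colored_digraph n k * {set 'I_n}) : Prop :=
  edge_operation s.2 s.1 s'.1 /\ derived_set s'.1 s.2 s'.2.

Definition ec_derived_set G VL D : Prop :=
  exists (D0 : {set 'I_n}) (G' : colored_digraph n k),
    [/\ derived_set G VL D0,
        clos_refl_trans _ ec_step (G, D0) (G', D)
      & forall s, clos_refl_trans _ ec_step (G', D) s -> s.2 = D].

End EdgeOperations.

(* Main.v *)
Require Import Defs.
From Stdlib Require Import Relation_Operators.
From mathcomp Require Import all_boot all_order all_fingroup all_algebra ring.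
From mathcomp Require Import reals topology normedtype derive.

(** Fix A in the colored qualitative class and let W be the space of row
    vectors z with z A^j B = 0 for every j; all that matters about W is that it
    is stable under z |-> z A and that B kills it.  Two independent facts are
    combined.

    Zero forcing.  Along the whole process every z in W vanishes on the black
    vertices.  At the leaders this says z B = 0.  If W vanishes on the black set
    C and u is black, then z A is in W too, so (z A)_u = 0: a linear equation
    between the values of z at the white out-neighbors of u.  For X in C with
    color-perfect white neighbor Y these equations form a square homogeneous
    system in the unknowns z_y, and its determinant, expanded over
    permutations and grouped by spectrum, is the sum over the equivalence
    classes of their signature times a product of nonzero weights
    ([det_perfect_matchings]).  Only one term survives, so the determinant is
    nonzero and z vanishes on Y ([color_perfect_forces_zero]).  An edge
    operation merely rewrites the equation of a black vertex: turning a color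
    rescales it, removing edges subtracts another equation from it.  Columns of
    white vertices are never touched, so a vertex that turns black later still
    contributes the equation of the original A.  These three properties form
    the invariant [forces_zero].  When all vertices are black, W = 0.

    No eigenvalue is involved, so the argument stays over the reals although
    A may have complex spectrum.

    From W = 0 to steering.  Let p be the characteristic polynomial of A and
    write adj(s - A) = sum_i H_(i+1) s^i, where H_i is [adj_coef i].  For any smooth y, the curves
    x = sum_i H_(i+1) B y^(i) and u = p(d/dt) y satisfy x' = A x + B u, because
    (s - A) adj(s - A) = p(s) ([flat_system]).  If W = 0 then every state is of
    the form sum_i H_(i+1) B a_i ([flat_state_surjective]), so it is enough to
    find y with prescribed derivatives at times 0 and 1, and Hermite
    interpolation gives a polynomial one.  Matrix exponentials, Gramians and
    integrals are thus avoided: states and inputs are polynomial in time. *)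

Set Implicit Arguments.
Unset Strict Implicit.
Unset Printing Implicit Defensive.

Import Order.TTheory GRing.Theory Num.Theory.
Import numFieldNormedType.Exports.

Local Open Scope ring_scope.

(** * Hermite interpolation *)

Section HermiteInterpolation.
Variable F : numFieldType.
Implicit Types (p q : {poly F}) (a b : nat -> F).

Lemma exists_poly_derivn d c a :
  exists p, forall i, (i < d)%N -> p^`(i).[c] = a i.
Proof.
pose q := \poly_(j < d) (a j / j`!%:R).
exists (q \Po ('X - c%:P)) => i id.
have derivn_shift j : (q \Po ('X - c%:P))^`(j) = q^`(j) \Po ('X - c%:P).
  elim: j => [|j IH]; first by rewrite !derivn0.
  by rewrite !derivnS IH deriv_comp derivB derivX derivC subr0 mulr1.
rewrite derivn_shift horner_comp !hornerE subrr horner_coef0 coef_derivn addn0 coef_poly.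
rewrite id ffactnn -[LHS]mulr_natr divfK //.
by rewrite pnatr_eq0 -lt0n fact_gt0.
Qed.

Lemma derivn_high_order_root d c q i :
  (i < d)%N -> (q * ('X - c%:P) ^+ d)^`(i).[c] = 0.
Proof.
suff [r ->] : exists r, (q * ('X - c%:P) ^+ d)^`(i) = r * ('X - c%:P) ^+ (d - i).
  rewrite -subn_gt0 => /prednK <-; rewrite exprSr.
  by rewrite mulrA hornerM hornerXsubC subrr mulr0.
elim: i => [|i [r IH]]; first by exists q; rewrite derivn0 subn0.
rewrite derivnS IH; case: (ltnP i d) => [id | di]; last first.
  exists r^`(); have /eqP -> : (d - i == 0)%N by [].
  have /eqP -> : (d - i.+1 == 0)%N by rewrite subn_eq0 leqW.
  by rewrite !expr0 !mulr1.
exists (r^`() * ('X - c%:P) + r *+ (d - i)).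
rewrite -(subnSK id) derivM deriv_exp /= derivB derivX derivC subr0 mul1r.
by rewrite exprS [RHS]mulrDl mulrA mulrnAr mulrnAl.
Qed.

(** Chinese remaindering: from u X^d + v (X - 1)^d = 1, the polynomial
    p0 + u X^d (p1 - p0) agrees with p0 modulo X^d and with p1 modulo
    (X - 1)^d, which fixes its derivatives of order less than d. *)
Lemma hermite_interpolation d a b :
  exists p, forall i, (i < d)%N -> p^`(i).[0] = a i /\ p^`(i).[1] = b i.
Proof.
have [p0 p0E] := exists_poly_derivn d 0 a; have [p1 p1E] := exists_poly_derivn d 1 b.
have : coprimep (('X - 0%:P) ^+ d) (('X - 1%:P) ^+ d : {poly F}).
  by apply/coprimep_expl/coprimep_expr/coprimep_XsubC2; rewrite subr0 oner_eq0.
move=> /Bezout_eq1_coprimepP [[u v] /= uvE].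
exists (p0 + u * ('X - 0%:P) ^+ d * (p1 - p0)) => i id; split.
  by rewrite derivnD hornerD p0E // mulrAC derivn_high_order_root // addr0.
have -> : p0 + u * ('X - 0%:P) ^+ d * (p1 - p0) =
    p1 + v * (p0 - p1) * ('X - 1%:P) ^+ d.
  have -> : u * ('X - 0%:P) ^+ d = 1 - v * ('X - 1%:P) ^+ d by rewrite -uvE addrK.
  by ring.
by rewrite derivnD hornerD p1E // derivn_high_order_root // addr0.
Qed.

End HermiteInterpolation.

(** * Steering along polynomial curves *)

Section PolynomialCurves.
Variable R : realType.
Implicit Types m n : nat.

Definition eval_mx m n (P : 'M[{poly R}]_(m, n)) (s : R) : 'M[R]_(m, n) :=
  map_mx (horner_eval s) P.

Lemma is_derive_eval_mx m n (P : 'M[{poly R}]_(m, n)) (t : R) :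
  is_derive t 1 (eval_mx P) (eval_mx (map_mx (@deriv R) P) t).
Proof.
have entryE i j : is_derive t (1 : R) (fun s : R => eval_mx P s i j)
    (P i j)^`().[t].
  suff -> : (fun s => eval_mx P s i j) = horner (P i j).
    exact: is_derive_poly.
  by apply: boolp.funext => s; rewrite mxE.
have dP : derivable (eval_mx P) t 1.
  by apply/derivable_mxP => i j; apply: ex_derive.
apply: DeriveDef => //.
rewrite derive_mx //; apply/matrixP=> i j.
by rewrite !mxE derive_val.
Qed.

Lemma continuous_eval_mx m n (P : 'M[{poly R}]_(m, n)) : continuous (eval_mx P).
Proof.
move=> t; apply: differentiable_continuous; apply/derivable1_diffP.
exact: (@ex_derive _ _ _ _ _ _ _ (is_derive_eval_mx P t)).
Qed.

Lemma eval_mxD m n (P Q : 'M[{poly R}]_(m, n)) s :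
  eval_mx (P + Q) s = eval_mx P s + eval_mx Q s.
Proof. exact: map_mxD. Qed.

Lemma eval_mx_constM m n p (M : 'M[R]_(m, n)) (P : 'M[{poly R}]_(n, p)) s :
  eval_mx (map_mx polyC M *m P) s = M *m eval_mx P s.
Proof.
rewrite /eval_mx map_mxM -map_mx_comp map_mx_id_in // => x y.
by rewrite /= /horner_eval hornerC.
Qed.

Lemma deriv_constM m n p (M : 'M[R]_(m, n)) (P : 'M[{poly R}]_(n, p)) :
  map_mx (@deriv R) (map_mx polyC M *m P) =
  map_mx polyC M *m map_mx (@deriv R) P.
Proof.
apply/matrixP => i j; rewrite !mxE raddf_sum; apply: eq_bigr => l _.
by rewrite !mxE /= derivM derivC mul0r add0r.
Qed.

Section FlatOutput.
Variables (n m : nat) (A : 'M[R]_n.+1) (B : 'M[R]_(n.+1, m)).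

Local Notation p := (char_poly A).
Local Notation d := (size p).

(** The polynomial matrix adj(s - A) is the sum over i of
    [adj_coef i.+1] s^i: [drop_poly] is Horner's scheme for the quotient of
    p(s) - p(A) by s - A.  The shift by one makes [adj_coef 0] equal to p(A). *)
Definition adj_coef i : 'M[R]_n.+1 := horner_mx A (drop_poly i p).

Lemma adj_coefS i : adj_coef i = (p`_i)%:M + A *m adj_coef i.+1.
Proof.
rewrite /adj_coef.
have -> : drop_poly i p = (p`_i)%:P + 'X * drop_poly i.+1 p.
  apply/polyP => -[|j]; rewrite !coefE ?addr0 ?add0n //=.
  by rewrite add0r addSnnS.
by rewrite rmorphD rmorphM /= horner_mx_C horner_mx_X.
Qed.

Lemma adj_coef0 : adj_coef 0 = 0.
Proof. by rewrite /adj_coef drop_poly0l Cayley_Hamilton. Qed.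

Lemma adj_coef_size : adj_coef d = 0.
Proof. by rewrite /adj_coef drop_poly_eq0 // rmorph0. Qed.

Lemma adj_coef_lead : adj_coef d.-1 = 1%:M.
Proof.
rewrite adj_coefS prednK ?size_poly_gt0 ?monic_neq0 ?char_poly_monic //.
have /monicP := char_poly_monic A; rewrite /lead_coef => ->.
by rewrite adj_coef_size mulmx0 addr0.
Qed.

Lemma adj_coefSr i : adj_coef i.+1 *m A = adj_coef i - (p`_i)%:M.
Proof.
have -> : adj_coef i.+1 *m A = A *m adj_coef i.+1.
  by apply/esym/comm_mx_horner.
by rewrite [adj_coef i]adj_coefS addrC addKr.
Qed.

(** The row vectors killed by every [adj_coef i *m B] form an A-stable space,
    since [adj_coef i.+1 *m A] and [adj_coef i] differ by a scalar, and B kills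
    it, since one of the [adj_coef i] is the identity.  Hence it is zero, and
    dually the ranges of the [adj_coef i *m B] span the state space. *)
Lemma flat_state_surjective :
  (forall S : 'rV[R]_n.+1 -> Prop, (forall z, S z -> S (z *m A)) ->
    (forall z, S z -> z *m B = 0) -> forall z, S z -> z = 0) ->
  forall x0 : 'cV[R]_n.+1, exists a : 'I_d -> 'cV[R]_m,
    x0 = \sum_(i < d) adj_coef i.+1 *m B *m a i.
Proof.
move=> ctrb x0.
have kernel0 (z : 'rV[R]_n.+1) : (forall i, z *m adj_coef i *m B = 0) -> z = 0.
  pose S (z : 'rV[R]_n.+1) := forall i, z *m adj_coef i *m B = 0.
  have SB y : S y -> y *m B = 0.
    by move=> /(_ d.-1); rewrite adj_coef_lead mulmx1.
  apply: (ctrb S) => // y Sy [|i]; first by rewrite adj_coef0 mulmx0 mul0mx.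
  have -> : y *m A *m adj_coef i.+1 = y *m (adj_coef i.+1 *m A).
    by rewrite -mulmxA; congr (_ *m _); apply: comm_mx_horner.
  by rewrite adj_coefSr mulmxBr mulmxBl Sy mul_mx_scalar -scalemxAl SB // scaler0 subr0.
pose T := (\sum_(i < d) <<(adj_coef i.+1 *m B)^T>>)%MS.
have Tfull : row_full T.
  (* A column of the cokernel of T, transposed, is killed by all adj_coef i *m B. *)
  rewrite -cokermx_eq0 -trmx_eq0; apply/eqP/row_matrixP => j; rewrite row0.
  apply: kernel0 => -[|i]; first by rewrite adj_coef0 mulmx0 mul0mx.
  have [di|id] := leqP d i.+1.
    by rewrite /adj_coef drop_poly_eq0 // rmorph0 mulmx0 mul0mx.
  have sub : ((adj_coef i.+1 *m B)^T <= T)%MS.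
    by rewrite -genmxE; apply: (sumsmx_sup (Ordinal (ltnW id))).
  have /submxP[E TE] := sub.
  rewrite -mulmxA -[_ *m B]trmxK TE -row_mul -trmx_mul -mulmxA mulmx_coker.
  by rewrite mulmx0 trmx0 row0.
have /sub_sumsmxP[u xE] := submx_full x0^T Tfull.
have /fin_all_exists[a aE] (i : 'I_d) : exists a,
    u i *m <<(adj_coef i.+1 *m B)^T>>%MS = a *m (adj_coef i.+1 *m B)^T.
  by apply/submxP/(submx_trans (submxMl _ _)); rewrite genmxE.
exists (fun i => (a i)^T).
apply: trmx_inj; rewrite xE raddf_sum; apply: eq_bigr => i _ /=.
by rewrite aE [RHS]trmx_mul trmxK.
Qed.

(** For an output Y with entries polynomial in time, [flat_state] is
    adj(d/dt - A) B Y and [flat_input] is p(d/dt) Y. *)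
Definition flat_state (Y : 'cV[{poly R}]_m) : 'cV[{poly R}]_n.+1 :=
  \sum_(i < d) map_mx polyC (adj_coef i.+1 *m B) *m map_mx (derivn i) Y.

Definition flat_input (Y : 'cV[{poly R}]_m) : 'cV[{poly R}]_m :=
  \sum_(i < d) map_mx polyC ((p`_i)%:M) *m map_mx (derivn i) Y.

(** The identity (s - A) adj(s - A) = p(s) applied to B Y: the sum for the
    derivative of the state is shifted by one index, and both boundary terms
    vanish, at 0 by the Cayley-Hamilton theorem. *)
Lemma flat_system (Y : 'cV[{poly R}]_m) :
  map_mx (@deriv R) (flat_state Y) =
  map_mx polyC A *m flat_state Y + map_mx polyC B *m flat_input Y.
Proof.
pose f i := map_mx polyC (adj_coef i *m B) *m map_mx (@derivn R i) Y.
have -> : map_mx (@deriv R) (flat_state Y) = \sum_(i < d) f i.+1.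
  rewrite /flat_state raddf_sum; apply: eq_bigr => i _ /=.
  rewrite deriv_constM; congr (_ *m _); apply/matrixP => ? ?.
  by rewrite !mxE derivnS.
have -> : \sum_(i < d) f i.+1 = \sum_(i < d) f i.
  transitivity (\sum_(i < d.+1) f i).
    have f0 : f 0 = 0 by rewrite /f adj_coef0 mul0mx map_mx0 mul0mx.
    by rewrite [RHS]big_ord_recl f0 add0r.
  have fd : f d = 0 by rewrite /f adj_coef_size mul0mx map_mx0 mul0mx.
  by rewrite big_ord_recr /= fd addr0.
rewrite !mulmx_sumr -big_split; apply: eq_bigr => i _ /=.
rewrite /f adj_coefS !mulmxA -!map_mxM -mulmxDl -map_mxD; congr (map_mx _ _ *m _).
by rewrite mulmxDl addrC mulmxA mul_mx_scalar mul_scalar_mx.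
Qed.

Lemma flat_state_at Y s : eval_mx (flat_state Y) s =
  \sum_(i < d) adj_coef i.+1 *m B *m eval_mx (map_mx (derivn i) Y) s.
Proof.
rewrite /flat_state /eval_mx raddf_sum; apply: eq_bigr => i _.
exact: eval_mx_constM.
Qed.

End FlatOutput.

(** The hypothesis is the Kalman rank condition in dual form, stated through
    stable predicates so that no Krylov matrix has to be written. *)
Lemma controllable_of_invariant_kernel n m (A : 'M[R]_n) (B : 'M[R]_(n, m)) :
  (forall S : 'rV[R]_n -> Prop, (forall z, S z -> S (z *m A)) ->
    (forall z, S z -> z *m B = 0) -> forall z, S z -> z = 0) ->
  controllable_pair A B.
Proof.
case: n A B => [|n] A B ctrb x0 x1.
  (* A zero-dimensional state space has a single state. *)
  exists 1, (fun=> 0), (fun=> 0); split=> // [t|t _||].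
  - exact: cst_continuous.
  - by rewrite [X in is_derive _ _ _ X]flatmx0; exact: is_derive_cst.
  - by rewrite [RHS]flatmx0.
  - by rewrite [RHS]flatmx0.
have [a aE] := flat_state_surjective ctrb x0.
have [b bE] := flat_state_surjective ctrb x1.
pose d := size (char_poly A).
pose extend (c : 'I_d -> 'cV[R]_m) l i := if insub i is Some j then c j l 0 else 0.
have /fin_all_exists[y yE] l := hermite_interpolation d (extend a l) (extend b l).
pose Y := \col_l y l.
have YE (s : R) c : (forall l i, (i < d)%N -> (y l)^`(i).[s] = extend c l i) ->
    forall i : 'I_d, eval_mx (map_mx (derivn i) Y) s = c i.
  move=> ysE i; apply/matrixP => l j.
  by rewrite !mxE /horner_eval ysE // /extend valK ord1.
exists 1, (eval_mx (flat_input A Y)), (eval_mx (flat_state A B Y)); split=> //.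
- exact: continuous_eval_mx.
- move=> t _; rewrite -!eval_mx_constM -eval_mxD -flat_system.
  exact: is_derive_eval_mx.
- rewrite flat_state_at aE; apply: eq_bigr => i _; congr (_ *m _).
  by apply: YE => l j jd; have [] := yE l j jd.
- rewrite flat_state_at bE; apply: eq_bigr => i _; congr (_ *m _).
  by apply: YE => l j jd; have [] := yE l j jd.
Qed.

End PolynomialCurves.

(** * Weighted colored digraphs *)

Section WeightedAdjacency.
Variables (F : numFieldType) (n k : nat).
Implicit Types (G : colored_digraph n k) (C X Y : {set 'I_n}).

(** What the edge operations preserve of [is_colored_digraph]: they may empty
    a color class. *)
Definition properly_colored G : Prop :=
  (forall e, e \in edges G <-> exists r, e \in color_class G r) /\
  forall e r s, e \in color_class G r -> e \in color_class G s -> r = s.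

Lemma is_colored_digraph_properly_colored G :
  is_colored_digraph G -> properly_colored G.
Proof.
case=> _ covG disjG _; split=> [e | e r s er es].
  rewrite -covG; split=> [/bigcupP[r _ er] | [r er]]; first by exists r.
  by apply/bigcupP; exists r.
apply/eqP; apply: contraT => /disjG.
by rewrite disjoint_subset => /subsetP/(_ _ er); rewrite !inE es.
Qed.

Lemma mem_turn_color G (E : {set 'I_n * 'I_n}) c r e :
  (e \in color_class (turn_color G E c) r) =
  if e \in E then r == c else e \in color_class G r.
Proof.
rewrite /=; case: (r == c); rewrite !inE; case: (e \in E) => //=.
  by rewrite orbT.
by rewrite orbF.
Qed.

Lemma white_edgesE G C u v j i :
  ((j, i) \in white_edges G C u v) =
  [&& j == v, (j, i) \in edges G & i \in white_neighbors G C [set u]].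
Proof. by rewrite inE /= andbCA. Qed.

Lemma mem_white_neighbors1 G C u i : i \notin C ->
  (i \in white_neighbors G C [set u]) = ((u, i) \in edges G).
Proof.
move=> iC; rewrite !inE iC /=; apply/existsP/idP => [[x]|e].
  by rewrite inE => /andP[/eqP->].
by exists u; rewrite inE eqxx.
Qed.

Lemma edge_operation_properly_colored C G G' :
  edge_operation C G G' -> properly_colored G -> properly_colored G'.
Proof.
case=> [u r c _ _ _ | u v _ _ _ _ _] [edgeG uniqG]; set D := white_edges _ _ _ _.
  split=> [e | e s t]; last first.
    by rewrite !mem_turn_color; case: ifP => _; [move=> /eqP-> /eqP-> | apply: uniqG].
  split=> [/edgeG[s es] | [s]].
    have [eD|eD] := boolP (e \in D).
      by exists c; rewrite mem_turn_color eD.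
    by exists s; rewrite mem_turn_color (negbTE eD).
  rewrite mem_turn_color; case: ifP => [|_ es]; first by rewrite inE => /andP[].
  by apply/edgeG; exists s.
split=> [e | e s t]; last by rewrite !inE => /andP[_ es] /andP[_]; apply: uniqG es.
split=> [/setDP[/edgeG[s es] eD] | [s /setDP[es eD]]].
  by exists s; apply/setDP.
by apply/setDP; split=> //; apply/edgeG; exists s.
Qed.

Variable w : 'I_k -> F.

(** Indexed like the matrices of the qualitative class: the entry (i, j)
    belongs to the edge from j to i. *)
Definition weighted_adjacency G : 'M[F]_n :=
  \matrix_(i, j) \sum_(r < k | (j, i) \in color_class G r) w r.

Lemma weighted_adjacency_edge G i j r : properly_colored G ->
  (j, i) \in color_class G r -> weighted_adjacency G i j = w r.
Proof.
move=> GP eG; rewrite mxE (bigD1 r) //= big1 ?addr0 // => s /andP[es].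
by rewrite (GP.2 _ _ _ es eG) eqxx.
Qed.

Lemma weighted_adjacency_nonedge G i j : properly_colored G ->
  (j, i) \notin edges G -> weighted_adjacency G i j = 0.
Proof.
move=> GP eG; rewrite mxE big_pred0 // => r; apply: contraNF eG => er.
by apply/GP.1; exists r.
Qed.

Lemma weighted_adjacency_turn_color G (E : {set 'I_n * 'I_n}) c i j : (j, i) \notin E ->
  weighted_adjacency (turn_color G E c) i j = weighted_adjacency G i j.
Proof.
by move=> e; rewrite !mxE; apply: eq_bigl => r; rewrite mem_turn_color (negbTE e).
Qed.

Lemma weighted_adjacency_remove_edges G (E : {set 'I_n * 'I_n}) i j : (j, i) \notin E ->
  weighted_adjacency (remove_edges G E) i j = weighted_adjacency G i j.
Proof. by move=> e; rewrite !mxE; apply: eq_bigl => r /=; rewrite inE e. Qed.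

Hypothesis w_neq0 : forall r, w r != 0.

(** In the Leibniz expansion the permutations that are not perfect matchings
    contribute 0, and the product of the entries along a perfect matching
    depends only on its spectrum. *)
Lemma det_perfect_matchings G t (x y : 'I_t -> 'I_n) : properly_colored G ->
  \det (\matrix_(i, j) weighted_adjacency G (y j) (x i)) =
  \sum_(K in matching_classes G x y)
     (signature K)%:~R * \prod_r w r ^+ (spectrum G x y (repr K) r).
Proof.
move=> GP; set W := weighted_adjacency G.
pose M := perfect_matchings G x y.
have -> : \det (\matrix_(i, j) W (y j) (x i)) =
    \sum_(g in M) (-1) ^+ g * \prod_i W (y (g i)) (x i).
  rewrite /determinant (bigID (mem M)) /= [X in _ + X]big1 ?addr0 => [|g].
    by apply: eq_bigr => g _; congr (_ * _); apply: eq_bigr => i _; rewrite mxE.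
  rewrite inE negb_forall => /existsP[i e].
  by rewrite (bigD1 i) //= mxE /W weighted_adjacency_nonedge // mul0r mulr0.
have prodE g : g \in M ->
    \prod_i W (y (g i)) (x i) = \prod_r w r ^+ (spectrum G x y g r).
  rewrite inE => /forallP gM.
  under [RHS]eq_bigr => r _ do rewrite ffunE -prodr_const.
  rewrite (exchange_big_dep xpredT) //=; apply: eq_bigr => i _.
  have /GP.1[r er] := gM i.
  rewrite /W (weighted_adjacency_edge GP er) (bigD1 r) ?inE //=.
  rewrite big1 ?mulr1 // => s /andP[]; rewrite inE => es.
  by rewrite (GP.2 _ _ _ es er) eqxx.
rewrite (set_partition_big _ (preim_partitionP (spectrum G x y) M)) /=.
apply: eq_bigr => K KM; rewrite /signature rmorph_sum mulr_suml /=.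
apply: eq_bigr => g gK; rewrite rmorphXn rmorphN1; congr (_ * _).
have /imsetP[h _ KE] := KM.
have repK : repr K \in K by apply: mem_repr gK.
move: gK repK; rewrite {1 3}KE !inE => /andP[gM /eqP hg] /andP[_ /eqP hr].
by rewrite prodE ?inE // -hr hg.
Qed.

(** The equations at the vertices of X involve z only on Y, because z vanishes
    on C and every white out-neighbor of X is in Y. *)
Lemma color_perfect_forces_zero G C X Y (z : 'rV[F]_n) : properly_colored G ->
  X \subset C -> color_perfect_white_neighbor G C X Y ->
  (forall u, u \in C -> z 0 u = 0) ->
  (forall u, u \in C -> (z *m weighted_adjacency G) 0 u = 0) ->
  forall v, v \in Y -> z 0 v = 0.
Proof.
move=> GP XC [eXY]; set x := fun i => _; set y := fun i => _.
move=> [YE _ /eqP/cards1P[K KE]] zC zW.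
pose M := \matrix_(i, j) weighted_adjacency G (y j) (x i).
have Mdet : \det M != 0.
  rewrite det_perfect_matchings // (bigID (fun K => signature K != 0)) /=.
  rewrite [X in _ + X]big1 ?addr0; last first.
    by move=> H /andP[_ /negPn/eqP->]; rewrite mul0r.
  rewrite (eq_bigl (mem [set K])) => [|H]; last by rewrite /= -KE inE.
  rewrite big_set1 mulf_neq0 ?prodf_seq_neq0 //.
    have : K \in [set K] by rewrite inE.
    by rewrite -KE inE intr_eq0 => /andP[].
  by apply/allP => r _; rewrite expf_neq0.
pose zy := \col_j z 0 (y j).
have Mz : M *m zy = 0.
  apply/matrixP => i j; rewrite !mxE.
  have xX : x i \in X by apply: enum_valP.
  have := zW _ (subsetP XC _ xX); rewrite mxE => zWx; rewrite -[RHS]zWx.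
  rewrite [RHS](bigID (mem Y)) /= [X in _ = _ + X]big1 ?addr0; last first.
    move=> v vY; have [vC|vC] := boolP (v \in C); first by rewrite zC ?mul0r.
    rewrite weighted_adjacency_nonedge ?mulr0 //; apply: contraNN vY => e.
    by rewrite YE !inE vC; apply/existsP; exists (x i); rewrite xX.
  rewrite [RHS]big_enum_val [RHS](reindex (cast_ord eXY)) /=; last first.
    by apply: onW_bij; exists (cast_ord (esym eXY)); [apply: cast_ordK|apply: cast_ordKV].
  by apply: eq_bigr => l _; rewrite !mxE mulrC.
have zy0 : zy = 0.
  by rewrite -[zy](@mulKmx _ _ _ M) ?Mz ?mulmx0 // unitmxE unitfE.
move=> v vY; pose l := cast_ord (esym eXY) (enum_rank_in vY v).
have := congr1 (fun u : 'cV_ _ => u l 0) zy0; rewrite !mxE => <-.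
by rewrite /y /l cast_ordKV enum_rankK_in.
Qed.

End WeightedAdjacency.

(** * The zero-forcing invariant *)

Section Invariant.
Variables (F : numFieldType) (n k : nat) (A : 'M[F]_n) (w : 'I_k -> F).
Variable S : 'rV[F]_n -> Prop.
Hypothesis w_neq0 : forall r, w r != 0.
Hypothesis S_stable : forall z, S z -> S (z *m A).
Implicit Types (G : colored_digraph n k) (C D : {set 'I_n}).

(** The last clause says that the edge operations have not yet altered the
    edges that leave a white vertex; it is what gives that vertex its equation
    when it turns black. *)
Definition forces_zero G C : Prop :=
  [/\ forall z u, S z -> u \in C -> z 0 u = 0,
      forall z u, S z -> u \in C -> (z *m weighted_adjacency w G) 0 u = 0
    & forall i j, j \notin C -> i != j -> weighted_adjacency w G i j = A i j].

(** Once u is black, z vanishes at u and the arbitrary diagonal entry of A at u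
    disappears from the equation (z A)_u = 0. *)
Lemma forces_zeroU G C Y :
  (forall z u, S z -> u \in C :|: Y -> z 0 u = 0) ->
  (forall z u, S z -> u \in C -> (z *m weighted_adjacency w G) 0 u = 0) ->
  (forall i j, j \notin C -> i != j -> weighted_adjacency w G i j = A i j) ->
  forces_zero G (C :|: Y).
Proof.
move=> zCY zW WA; split=> // [z u Sz uCY | i j]; last first.
  by rewrite inE negb_or => /andP[jC _]; apply: WA.
have [uC|uC] := boolP (u \in C); first exact: zW.
rewrite -[RHS](zCY _ _ (S_stable Sz) uCY) !mxE; apply: eq_bigr => i _.
by have [->|iu] := eqVneq i u; [rewrite zCY ?mul0r | rewrite WA].
Qed.

Lemma color_change_forces_zero G C D : properly_colored G ->
  color_change G C D -> forces_zero G C -> forces_zero G D.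
Proof.
move=> GP [X [Y [XC XY ->]]] [zC zW WA]; apply: forces_zeroU => // z u Sz.
rewrite inE => /orP[|]; first exact: zC.
by apply: (color_perfect_forces_zero w_neq0 GP XC XY) => v; [apply: zC|apply: zW].
Qed.

Lemma derived_set_forces_zero G C D : properly_colored G ->
  derived_set G C D -> forces_zero G C -> forces_zero G D.
Proof.
move=> GP [CD _]; elim: CD => // {C D} [C D|C D E _ IH1 _ IH2 /IH1/IH2 //].
exact: color_change_forces_zero.
Qed.

Lemma forces_zero_replace_column G G' C v : v \in C ->
  (forall i j, j != v -> weighted_adjacency w G' i j = weighted_adjacency w G i j) ->
  (forall z, S z -> (z *m weighted_adjacency w G') 0 v = 0) ->
  forces_zero G C -> forces_zero G' C.
Proof.
move=> vC WE zWv [zC zW WA]; split=> // [z u Sz uC | i j jC ij].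
  have [->|uv] := eqVneq u v; first exact: zWv.
  by rewrite -[RHS](zW z u Sz uC) !mxE; apply: eq_bigr => i _; rewrite WE.
by rewrite WE ?WA //; apply: contraNneq jC => ->.
Qed.

(** On the white out-neighbors of u the column of u is multiplied by
    w c / w r, and elsewhere the column meets only zeros of z or of itself. *)
Lemma turn_color_forces_zero G C u r c : properly_colored G ->
  u \in C -> white_edges G C u u \subset color_class G r ->
  forces_zero G C -> forces_zero (turn_color G (white_edges G C u u) c) C.
Proof.
move=> GP uC Dr inv; have [zC zW _] := inv.
apply: (forces_zero_replace_column uC _ _ inv) => [i j ju | z Sz].
  by rewrite weighted_adjacency_turn_color // white_edgesE (negbTE ju).
rewrite -(mulr0 (w c / w r)) -(zW z u Sz uC) !mxE mulr_sumr.
apply: eq_bigr => i _; have [iC|iC] := boolP (i \in C).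
  by rewrite zC // !mul0r mulr0.
have [e|e] := boolP ((u, i) \in white_edges G C u u).
  rewrite (weighted_adjacency_edge w GP (subsetP Dr _ e)).
  suff -> : weighted_adjacency w (turn_color G (white_edges G C u u) c) i u = w c.
    by rewrite mulrCA divfK.
  rewrite mxE (big_pred1 c) // => s; by rewrite mem_turn_color e.
rewrite weighted_adjacency_turn_color // weighted_adjacency_nonedge ?mulr0 //.
by move: e; rewrite white_edgesE eqxx mem_white_neighbors1 //= andbb.
Qed.

(** On white vertices the new column of v is the old column of v minus the
    column of u. *)
Lemma remove_edges_forces_zero G C u v : properly_colored G ->
  properly_colored (remove_edges G (white_edges G C u v)) ->
  u \in C -> v \in C ->
  (forall j, j \in white_neighbors G C [set u] -> same_color G (u, j) (v, j)) ->
  forces_zero G C -> forces_zero (remove_edges G (white_edges G C u v)) C.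
Proof.
move=> GP GP' uC vC uvN inv; have [zC zW _] := inv.
apply: (forces_zero_replace_column vC _ _ inv) => [i j jv | z Sz].
  by rewrite weighted_adjacency_remove_edges // white_edgesE (negbTE jv).
rewrite -[RHS]subr0 -{1}(zW z v Sz vC) -(zW z u Sz uC) !mxE -sumrB.
apply: eq_bigr => i _; have [iC|iC] := boolP (i \in C).
  by rewrite zC // !mul0r subr0.
have [iN|iN] := boolP (i \in white_neighbors G C [set u]).
  have [r [er ev]] := uvN _ iN.
  rewrite (weighted_adjacency_edge w GP er) (weighted_adjacency_edge w GP ev) subrr.
  rewrite weighted_adjacency_nonedge ?mulr0 //= in_setD white_edgesE eqxx iN.
  by rewrite andbT andNb.
rewrite weighted_adjacency_remove_edges ?white_edgesE ?(negbTE iN) ?andbF //.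
rewrite [X in _ - _ * X]weighted_adjacency_nonedge ?mulr0 ?subr0 //.
by rewrite -(mem_white_neighbors1 _ _ iC) (negbTE iN).
Qed.

Lemma edge_operation_forces_zero G G' C : properly_colored G ->
  edge_operation C G G' -> forces_zero G C -> forces_zero G' C.
Proof.
move=> GP op; have GP' := edge_operation_properly_colored op GP.
case: op GP' => [u r c uC Dr _ _ | u v uC vC _ _ uvN GP'].
  exact: turn_color_forces_zero Dr.
exact: remove_edges_forces_zero.
Qed.

Lemma ec_steps_force_zero s s' :
  clos_refl_trans _ (@ec_step n k) s s' ->
  properly_colored s.1 -> forces_zero s.1 s.2 ->
  properly_colored s'.1 /\ forces_zero s'.1 s'.2.
Proof.
elim=> {s s'} [s s' [op der] | // | s1 s2 s3 _ IH1 _ IH2] GP zC.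
  have GP' := edge_operation_properly_colored op GP; split=> //.
  exact/(derived_set_forces_zero GP' der)/(edge_operation_forces_zero GP op).
by have [] := IH1 GP zC; apply: IH2.
Qed.

End Invariant.

(** * Strong structural controllability *)

(** The weights are read off A once and stay fixed while the graph is modified.
    Nonempty classes give every color a weight, so that an edge may be turned
    to any color, even one whose class has become empty in the meantime. *)
Lemma exists_color_weights (F : fieldType) n k (G : colored_digraph n k)
    (A : 'M[F]_n) :
  is_colored_digraph G ->
  (forall i j, i != j -> (A i j != 0 <-> (j, i) \in edges G)) ->
  (forall i j p q, same_color G (j, i) (q, p) -> A i j = A p q) ->
  exists w : 'I_k -> F, (forall r, w r != 0) /\
    forall i j r, (j, i) \in color_class G r -> A i j = w r.
Proof.
move=> GD Aedge Acol; have [edgeG _] := is_colored_digraph_properly_colored GD.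
have [loopless _ _ nonempty] := GD.
have /fin_all_exists[e eP] r : exists e, e \in color_class G r.
  exact/set0Pn/nonempty.
exists (fun r => A (e r).2 (e r).1); split=> [r | i j r ijr]; last first.
  by apply: Acol; exists r; rewrite -surjective_pairing.
have e_edge : e r \in edges G by apply/edgeG; exists r.
apply/Aedge; last by rewrite -surjective_pairing.
by apply: contraTneq e_edge => e21; rewrite [e r]surjective_pairing e21.
Qed.

Lemma leader_mx_kernel (R : realType) n (VL : {set 'I_n}) (z : 'rV[R]_n) v :
  z *m leader_mx R VL = 0 -> v \in VL -> z 0 v = 0.
Proof.
move=> zB vL; have := congr1 (fun u : 'rV_ _ => u 0 (enum_rank_in vL v)) zB.
rewrite !mxE (bigD1 v) //= !mxE enum_rankK_in // eqxx mulr1 big1 ?addr0 // => i iv.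
by rewrite mxE enum_rankK_in // (negbTE iv) mulr0.
Qed.

Theorem theorem22 (R : realType) (n k : nat) (G : colored_digraph n k)
    (VL Dec : {set 'I_n}) :
  is_colored_digraph G ->
  ec_derived_set G VL Dec ->
  Dec = [set: 'I_n] ->
  controllable R G VL.
Proof.
move=> GD [D0 [G' [derD0 steps _]]] DecT; rewrite {}DecT in steps.
move=> A [Aedge Acol].
have GP := is_colored_digraph_properly_colored GD.
have [w [w_neq0 Aw]] := exists_color_weights GD Aedge Acol.
apply: controllable_of_invariant_kernel => S S_stable SB z Sz.
(* The invariant holds trivially when no vertex is black; the leaders are then
   added all at once. *)
have inv_leaders : forces_zero A w S G VL.
  rewrite -[VL]set0U; apply: (forces_zeroU S_stable) => [y u Sy | y u _ | i j _ ij].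
  - by rewrite set0U; apply/leader_mx_kernel/SB.
  - by rewrite inE.
  have [e|e] := boolP ((j, i) \in edges G).
    have /GP.1[r er] := e.
    by rewrite (weighted_adjacency_edge w GP er) (Aw _ _ _ er).
  rewrite weighted_adjacency_nonedge //; apply/esym/eqP; apply: contraNT e.
  by move/(Aedge _ _ ij).
have inv_D0 := derived_set_forces_zero w_neq0 S_stable GP derD0 inv_leaders.
have [_ [zV _ _]] := ec_steps_force_zero w_neq0 S_stable steps GP inv_D0.
by apply/rowP => v; rewrite mxE; apply: zV (in_setT v).
Qed.
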